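(* Let $a_1,a_2\in\mathbb R$ and let $F(\psi,x)=\frac12 a_2x^2+a_1x+b(x)\cos\psi$ on $\mathbb T\times(0,1)$, where $b(x)=\sqrt{(1-x)^3x}$. Let $Z_{10},Z_{12},Z_{21},Z_{01}\subset\mathbb R^2$ be the regions defined in the context. If $(a_1,a_2)\in Z_{ij}$, then the function $x\mapsto F(0,x)$ on $(0,1)$ has exactly $i$ critical points and the function $x\mapsto F(\pi,x)$ on $(0,1)$ has exactly $j$ critical points. More precisely: (1) If $(a_1,a_2)\in Z_{10}$, then $F(0,\cdot)$ has a local maximum with positive value at some $x_1^{(0)}\in(0,1)$, and $F(\pi,\cdot)$ is strictly decreasing. (2) If $(a_1,a_2)\in Z_{01}$, then $F(\pi,\cdot)$ has a local minimum with negative value at some $x_1^{(\pi)}\in(0,1)$, and $F(0,\cdot)$ is strictly increasing. (3) If $(a_1,a_2)\in Z_{12}$, then $F(0,\cdot)$ has a local maximum with positive value at some $x_1^{(0)}\in(0,1)$, while $F(\pi,\cdot)$ has a local minimum with negative value at some $x_1^{(\pi)}$ and a local maximum at some $x_2^{(\pi)}$, with $0<x_1^{(\pi)}<x_2^{(\pi)}<1$. (4) If $(a_1,a_2)\in Z_{21}$, then $F(0,\cdot)$ has a local maximum with positive value at some $x_1^{(0)}$ and a local minimum at some $x_2^{(0)}$, with $0<x_1^{(0)}<x_2^{(0)}<1$, while $F(\pi,\cdot)$ has a local minimum with negative value at some $x_1^{(\pi)}\in(0,1)$. As a corollary, if $(a_1,a_2)\in Z_{ij}$, then $F$, as a function of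 two variables on $\mathbb T\times(0,1)$, has exactly $i$ critical points of the form $(0,x)$ and exactly $j$ critical points of the form $(\pi,x)$. More precisely, with the same points: (1') if $(a_1,a_2)\in Z_{10}$, $F$ has a local maximum with positive value at $(0,x_1^{(0)})$; (2') if $(a_1,a_2)\in Z_{01}$, $F$ has a local minimum with negative value at $(\pi,x_1^{(\pi)})$; (3') if $(a_1,a_2)\in Z_{12}$, $F$ has a local maximum with positive value at $(0,x_1^{(0)})$, a local minimum with negative value at $(\pi,x_1^{(\pi)})$ and a saddle at $(\pi,x_2^{(\pi)})$; (4') if $(a_1,a_2)\in Z_{21}$, $F$ has a local maximum with positive value at $(0,x_1^{(0)})$, a saddle at $(0,x_2^{(0)})$ and a local minimum with negative value at $(\pi,x_1^{(\pi)})$.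
   Context: $\mathbb T=\mathbb R/2\pi\mathbb Z$; points of $\mathbb T\times(0,1)$ are written $(\psi,x)$. Set $$g(a_1):=\tfrac1{27}\big(\sqrt{9+4a_1^2}-2a_1\big)\big(9-4a_1^2-4a_1\sqrt{9+4a_1^2}\big),$$ which satisfies $g(a_1)>-a_1$ (hence $-g(-a_1)<-a_1$) for every $a_1\in\mathbb R$. The regions are $$Z_{10}:=\{(a_1,a_2): a_2<-g(-a_1)\},\quad Z_{12}:=\{(a_1,a_2): -g(-a_1)<a_2<-a_1\},$$ $$Z_{21}:=\{(a_1,a_2): -a_1<a_2<g(a_1)\},\quad Z_{01}:=\{(a_1,a_2): a_2>g(a_1)\}.$$ A saddle is a critical point which is neither a local maximum nor a local minimum. ''With positive (negative) value'' means that the value of the function at that point is positive (negative). *)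

(* Defs.v *)
From HB Require Import structures.
From mathcomp Require Import all_boot all_order all_algebra.
From mathcomp Require Import ring_quotient.
From mathcomp Require Import all_classical all_reals all_analysis.

Set Implicit Arguments.
Unset Strict Implicit.
Unset Printing Implicit Defensive.

Import Order.TTheory GRing.Theory Num.Theory.
Import numFieldTopology.Exports numFieldNormedType.Exports.

Local Open Scope classical_set_scope.
Local Open Scope ring_scope.

Definition two_pi_Z {R : realType} : {pred R} :=
  fun s => s / (pi *+ 2) \is a Num.int.

Lemma two_pi_Z_zmod_closed (R : realType) : zmod_closed (@two_pi_Z R).
Proof.
split=> [|s t]; first by rewrite unfold_in /two_pi_Z mul0r.
by rewrite !unfold_in /two_pi_Z mulrBl => hs ht; exact: rpredB.
Qed.

HB.instance Definition _ (R : realType) :=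
  GRing.isZmodClosed.Build R (@two_pi_Z R) (@two_pi_Z_zmod_closed R).

Definition circle (R : realType) : Type :=
  quotient_topology (Quotient.quot (@two_pi_Z R)).

HB.instance Definition _ (R : realType) := Topological.on (circle R).
HB.instance Definition _ (R : realType) := Quotient.on (circle R).

Definition angle {R : realType} (s : R) : circle R := (\pi_(circle R) s)%qT.

Definition ccos {R : realType} (psi : circle R) : R := cos (repr psi).

Lemma angle_eq (R : realType) (s t : R) :
  angle s = angle t <-> (s - t) / (pi *+ 2) \is a Num.int.
Proof.
have -> : ((s - t) / (pi *+ 2) \is a Num.int) = ((s - t) \in @two_pi_Z R) by [].
rewrite Quotient.idealrBE; split=> [h|/eqP h]; [apply/eqP|]; exact: h.
Qed.

Lemma ccos_angle (R : realType) (s : R) : ccos (angle s) = cos s.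
Proof.
have h : angle (repr (angle s)) = angle s by rewrite [LHS]reprK.
have [m hm] := intrP (proj1 (angle_eq _ _) h).
have pi2_neq0 : (pi *+ 2 : R) != 0 by rewrite lt0r_neq0 // pmulrn_lgt0 // pi_gt0.
have hr : repr (angle s) = s + (pi *+ 2) *~ m.
  by rewrite -mulrzl -hm divfK // addrC subrK.
rewrite /ccos hr; case: m {hm hr} => n; first exact: (periodicn (@cosD2pi R)).
by rewrite NegzE mulrNz -[LHS](periodicn (@cosD2pi R) n.+1) subrK.
Qed.

Definition bfun {R : realType} (x : R) : R := Num.sqrt ((1 - x) ^+ 3 * x).

(* Only the values at 0 < x < 1 are meaningful; everything below is restricted
   to [I01] or [annulus]. *)
Definition Ffun {R : realType} (a1 a2 : R) (p : circle R * R) : R :=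
  2^-1 * a2 * p.2 ^+ 2 + a1 * p.2 + bfun p.2 * ccos p.1.

Definition gfun {R : realType} (a : R) : R :=
  27^-1 * (Num.sqrt (9 + 4 * a ^+ 2) - 2 * a)
        * (9 - 4 * a ^+ 2 - 4 * a * Num.sqrt (9 + 4 * a ^+ 2)).

Definition Zreg (R : realType) (i j : nat) : set (R * R) :=
  match i, j with
  | 1%N, 0%N => [set a : R * R | a.2 < - gfun (- a.1)]
  | 1%N, 2%N => [set a : R * R | - gfun (- a.1) < a.2 < - a.1]
  | 2%N, 1%N => [set a : R * R | - a.1 < a.2 < gfun a.1]
  | 0%N, 1%N => [set a : R * R | gfun a.1 < a.2]
  | _, _ => set0
  end.
Arguments Zreg R i j : clear implicits.

Definition I01 {R : realType} : set R := [set x | 0 < x < 1].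

Definition annulus {R : realType} : set (circle R * R) := setT `*` I01.

Section LocalExtrema.
Context {R : realType} {X : topologicalType}.
Implicit Types (D : set X) (f : X -> R) (p : X).

Definition loc_max D f p := D p /\ \forall q \near p, D q -> f q <= f p.

Definition loc_min D f p := D p /\ \forall q \near p, D q -> f p <= f q.

End LocalExtrema.

Definition crit1 {R : realType} (f : R -> R) (x : R) : Prop :=
  I01 x /\ is_derive x (1 : R) f 0.

(* The differential is read in the local coordinates (s, x) |-> (angle s, x). *)
Definition crit2 {R : realType} (G : circle R * R -> R) (p : circle R * R) :
    Prop :=
  annulus p /\
  forall s : R, angle s = p.1 ->
    is_diff (s, p.2) (fun q : R * R => G (angle q.1, q.2)) (cst 0).

Definition saddle2 {R : realType} (G : circle R * R -> R) (p : circle R * R) :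
    Prop :=
  [/\ crit2 G p, ~ loc_max annulus G p & ~ loc_min annulus G p].

(* Main.v *)
Require Import Defs.
From mathcomp Require Import all_boot all_order all_algebra.
From mathcomp Require Import all_classical all_reals all_analysis.
From mathcomp Require Import ring lra.
Import Order.TTheory GRing.Theory Num.Theory.
Import numFieldTopology.Exports numFieldNormedType.Exports.
Local Open Scope classical_set_scope.
Local Open Scope ring_scope.
Local Open Scope card_scope.

(* With t = sqrt (1/x - 1), a decreasing bijection from (0, 1) to (0, +oo), the
   derivative of h(x) = a2 x^2 / 2 + a1 x + b(x) is
   (x / 2) (t^3 + 2 a1 t^2 - 3 t + 2 (a1 + a2)), so the critical points of
   F(0, .) are governed by the positive roots of a cubic in t. On t > 0 the
   cubic has its minimum 2 (a2 - g(a1)) at the positive root of its derivative,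
   and its value at t = 0 is 2 (a1 + a2): this gives one, two or no positive
   roots according to the position of a2 with respect to -a1 and g(a1).
   F(pi, .) is reduced to the same analysis by F_a(pi, .) = - F_(-a)(0, .).
   Since b > 0, F(psi, x) <= F(0, x) and F(psi, x) >= F(pi, x), so a maximum of
   F(0, .) and a minimum of F(pi, .) are local extrema of F, while a minimum of
   F(0, .) or a maximum of F(pi, .) is a saddle. *)

(** * Positive roots of the cubic *)

Definition cubic {R : realType} (a1 a2 t : R) : R :=
  t ^+ 3 + 2 * a1 * t ^+ 2 - 3 * t + 2 * (a1 + a2).

Lemma cubic_ivt (R : realType) (a1 a2 u v : R) : u <= v ->
  cubic a1 a2 u <= 0 <= cubic a1 a2 v \/ cubic a1 a2 v <= 0 <= cubic a1 a2 u ->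
  exists2 t, u <= t <= v & cubic a1 a2 t = 0.
Proof.
move=> uv.
pose p : {poly R} :=
  'X^3 + (2 * a1) *: 'X^2 - 3 *: 'X + (2 * (a1 + a2))%:P.
have pE t : p.[t] = cubic a1 a2 t.
  rewrite /p !(hornerD, hornerN, hornerZ, hornerXn, hornerX, hornerC) /cubic.
  ring.
case=> h.
  have [|t tuv /rootP pt] := @poly_ivt _ p u v uv; rewrite ?pE //.
  by exists t => //; rewrite -pE.
(* [poly_ivt] expects a change of sign from nonpositive to nonnegative; the opposite pattern is
   treated through [- p]. *)
have [|t tuv /rootP pt] := @poly_ivt _ (- p) u v uv.
  by rewrite !hornerN !pE; lra.
exists t => //; rewrite -pE; move: pt.
by rewrite hornerN => /eqP; rewrite oppr_eq0 => /eqP.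
Qed.

Lemma cubic_large (R : realType) (a1 a2 u : R) :
  exists2 v, u < v & 0 < cubic a1 a2 v.
Proof.
(* Chosen so that [v >= 4] and [v + 2 * a1 >= 4 + |2 * (a1 + a2)|]: then [v ^+ 2 * (v + 2 * a1)]
   dominates both [3 * v] and the constant term. *)
pose v := `|u| + `|2 * a1| + 4 + `|2 * (a1 + a2)|.
exists v.
  have := ler_norm u; have := normr_ge0 (2 * a1).
  by have := normr_ge0 (2 * (a1 + a2)); rewrite /v; lra.
have u0 := normr_ge0 u.
have a0 := normr_ge0 (2 * a1); have c0 := normr_ge0 (2 * (a1 + a2)).
have aN := ler_norm (- (2 * a1)); have cN := ler_norm (- (2 * (a1 + a2))).
rewrite normrN in aN; rewrite normrN in cN.
have v4 : 4 <= v by rewrite /v; lra.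
have v2 : 4 * v <= v ^+ 2 by rewrite expr2 ler_wpM2r//; lra.
have -> : cubic a1 a2 v = v ^+ 2 * (v + 2 * a1) - 3 * v + 2 * (a1 + a2).
  by rewrite /cubic; ring.
have w : 4 + `|2 * (a1 + a2)| <= v + 2 * a1 by rewrite {1}/v; lra.
have : v ^+ 2 * (4 + `|2 * (a1 + a2)|) <= v ^+ 2 * (v + 2 * a1).
  by rewrite ler_wpM2l// sqr_ge0.
have : 1 * `|2 * (a1 + a2)| <= v ^+ 2 * `|2 * (a1 + a2)|.
  by rewrite ler_wpM2r//; lra.
by lra.
Qed.

(** The value at 0 is negative, so there is a root [t1 > 0]. Dividing by [t - t1] leaves a quadratic
    with constant term [c], where [t1 * c = - 2 (a1 + a2) > 0], and linear coefficient
    [t1 + 2 * a1 = (c + 3) / t1 > 0]; it is thus positive for [t > 0]. *)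
Lemma cubic_one_root (R : realType) (a1 a2 : R) : a2 < - a1 ->
  exists t1, [/\ 0 < t1, cubic a1 a2 t1 = 0,
    forall t, 0 < t -> t < t1 -> cubic a1 a2 t < 0
  & forall t, t1 < t -> 0 < cubic a1 a2 t].
Proof.
move=> ha.
have c0 : cubic a1 a2 0 < 0 by rewrite /cubic; lra.
have [v v0 cv] := cubic_large _ a1 a2 0.
have [||t1 /andP[t10 _] ct1] := cubic_ivt _ a1 a2 0 v; [lra|by left; lra|].
have {}t10 : 0 < t1.
  by rewrite lt_neqAle t10 andbT; apply/eqP => t1E; move: ct1; rewrite -t1E; lra.
pose c := t1 ^+ 2 + 2 * a1 * t1 - 3.
have c_gt0 : 0 < c.
  have : t1 * c = - (2 * (a1 + a2)) by move: ct1; rewrite /cubic /c; lra.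
  by move=> tc; rewrite -(pmulr_rgt0 _ t10) tc; lra.
have q0 : 0 < t1 + 2 * a1.
  by rewrite -(pmulr_rgt0 _ t10); move: c_gt0; rewrite /c; lra.
have cE t : cubic a1 a2 t = (t - t1) * (t ^+ 2 + (t1 + 2 * a1) * t + c).
  by rewrite -[LHS]subr0 -ct1 /cubic /c; ring.
have Q t : 0 < t -> 0 < t ^+ 2 + (t1 + 2 * a1) * t + c.
  by move=> t0; have := exprn_gt0 2 t0; have := mulr_gt0 q0 t0; lra.
exists t1; split=> // t.
  by move=> t0 tt1; rewrite cE nmulr_rlt0 ?subr_lt0// Q.
by move=> tt1; rewrite cE mulr_gt0 ?subr_gt0// Q//; lra.
Qed.

(* The positive root of the derivative of the cubic; the value of the cubic
   there is where the function g comes from. *)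
Definition cubic_argmin {R : realType} (a1 : R) : R :=
  (Num.sqrt (9 + 4 * a1 ^+ 2) - 2 * a1) / 3.

Section CubicArgmin.
Context {R : realType} (a1 : R).

Let s := Num.sqrt (9 + 4 * a1 ^+ 2).

Let s2 : s ^+ 2 = 9 + 4 * a1 ^+ 2.
Proof. by rewrite sqr_sqrtr// addr_ge0// mulr_ge0// sqr_ge0. Qed.

Let s_bnd : 2 * `|a1| < s.
Proof.
rewrite -ltr_sqr ?nnegrE ?mulr_ge0 ?sqrtr_ge0// s2 exprMn (real_normK (num_real _)).
by have := sqr_ge0 a1; lra.
Qed.

Lemma cubic_argmin_gt0 : 0 < cubic_argmin a1.
Proof. by rewrite /cubic_argmin -/s; have := ler_norm a1; have := s_bnd; lra. Qed.

Lemma cubic_argmin_root :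
  3 * cubic_argmin a1 ^+ 2 + 4 * a1 * cubic_argmin a1 - 3 = 0.
Proof.
have -> : 3 * cubic_argmin a1 ^+ 2 + 4 * a1 * cubic_argmin a1 - 3 =
  3^-1 * (s ^+ 2 - (9 + 4 * a1 ^+ 2)) by rewrite /cubic_argmin -/s; field.
by rewrite s2 subrr mulr0.
Qed.

Lemma cubic_at_argmin a2 : cubic a1 a2 (cubic_argmin a1) = 2 * (a2 - gfun a1).
Proof.
(* For an indeterminate [s] the two sides differ by a multiple of [s ^+ 2 - (9 + 4 * a1 ^+ 2)]; with
   the cofactor written out, [field] needs no knowledge of the square root. *)
have -> : cubic a1 a2 (cubic_argmin a1) =
  2 * (a2 - gfun a1)
  + (s ^+ 2 - (9 + 4 * a1 ^+ 2)) * (27^-1 * s - 8 * 27^-1 * a1).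
  by rewrite /cubic /cubic_argmin /gfun -/s; field.
by rewrite s2 subrr mul0r addr0.
Qed.

(** [2 (g(a1) + a1)] is the drop of the cubic from [t = 0] to its minimum. Eliminating [a1] by the
    equation of the critical point [t] turns this drop into [t (t^2 + 3) / 2]. *)
Lemma gfun_gtN : - a1 < gfun a1.
Proof.
have h := cubic_at_argmin 0; have r := cubic_argmin_root.
have t0 := cubic_argmin_gt0; set t := cubic_argmin a1 in h r t0.
have : 2 * (gfun a1 + a1) = 2^-1 * (t * (t ^+ 2 + 3)).
  have -> : 2 * (gfun a1 + a1) = 2 * (a1 + 0) - cubic a1 0 t by rewrite h; ring.
  have -> : 2 * (a1 + 0) - cubic a1 0 t =
    2^-1 * (t * (t ^+ 2 + 3)) - 2^-1 * t * (3 * t ^+ 2 + 4 * a1 * t - 3).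
    by rewrite /cubic; field.
  by rewrite r mulr0 subr0.
have : 0 < t * (t ^+ 2 + 3) by rewrite mulr_gt0// ltr_wpDl ?sqr_ge0.
by lra.
Qed.

Lemma cubic_gt0 a2 : gfun a1 < a2 -> forall t, 0 < t -> 0 < cubic a1 a2 t.
Proof.
move=> ga t t0; set u := cubic_argmin a1.
(* Taylor expansion at the minimum [u], with the derivative at [u] in the last term. The cofactor of
   the square is nonnegative because [2 u + 2 a1 = 2 (s + a1) / 3]. *)
have -> : cubic a1 a2 t = cubic a1 a2 u + (t - u) ^+ 2 * (t + 2 * u + 2 * a1)
    + (t - u) * (3 * u ^+ 2 + 4 * a1 * u - 3).
  by rewrite /cubic; ring.
rewrite cubic_argmin_root mulr0 addr0 ltr_wpDr//.
  rewrite mulr_ge0 ?sqr_ge0// /u /cubic_argmin -/s.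
  have := ler_norm (- a1); rewrite normrN.
  by have := normr_ge0 a1; have := s_bnd; lra.
by rewrite cubic_at_argmin; lra.
Qed.

Lemma cubic_two_roots a2 : - a1 < a2 < gfun a1 ->
  exists t1 t2, [/\ 0 < t1 < t2, cubic a1 a2 t1 = 0, cubic a1 a2 t2 = 0
  & [/\ forall t, 0 < t -> t < t1 -> 0 < cubic a1 a2 t,
        forall t, t1 < t -> t < t2 -> cubic a1 a2 t < 0
      & forall t, t2 < t -> 0 < cubic a1 a2 t]].
Proof.
move=> /andP[a12 a2g]; have u0 := cubic_argmin_gt0.
have cu : cubic a1 a2 (cubic_argmin a1) < 0 by rewrite cubic_at_argmin; lra.
set u := cubic_argmin a1 in u0 cu.
have c0 : 0 < cubic a1 a2 0 by rewrite /cubic; lra.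
have [v uv cv] := cubic_large _ a1 a2 u.
have [||t1 /andP[t10 t1u] ct1] := cubic_ivt _ a1 a2 0 u; [lra|by right; lra|].
have [||t2 /andP[ut2 t2v] ct2] := cubic_ivt _ a1 a2 u v; [lra|by left; lra|].
have {}t10 : 0 < t1.
  by rewrite lt_neqAle t10 andbT; apply/eqP => t1E; move: ct1; rewrite -t1E; lra.
have {}t1u : t1 < u.
  by rewrite lt_neqAle t1u andbT; apply/eqP => t1E; move: ct1; rewrite t1E; lra.
have t12 : t1 < t2 by lra.
(* The divided difference of the cubic at [t1] and [t2]; its vanishing allows both roots to be
   factored out. *)
have e : t1 ^+ 2 + t1 * t2 + t2 ^+ 2 + 2 * a1 * (t1 + t2) - 3 = 0.
  have /eqP : (t2 - t1) * (t1 ^+ 2 + t1 * t2 + t2 ^+ 2 + 2 * a1 * (t1 + t2) - 3)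
      = 0.
    by rewrite -[RHS](subrr 0) -{1}ct2 -ct1 /cubic; ring.
  by rewrite mulf_eq0 => /orP[/eqP|/eqP//]; lra.
(* The three roots sum to [- 2 * a1], so the third one is [- t3]. It is negative since
   [t1 * t2 * t3] is the value of the cubic at 0. *)
pose t3 := t1 + t2 + 2 * a1.
have cE t : cubic a1 a2 t = (t - t1) * ((t - t2) * (t + t3)).
  rewrite -[LHS]subr0 -ct1.
  rewrite -[RHS]addr0 -[in RHS](mulr0 (t - t1)) -[in RHS]e /cubic /t3; ring.
have t3_gt0 : 0 < t3.
  rewrite -(pmulr_rgt0 _ t10) -(pmulr_lgt0 _ (lt_trans t10 t12)).
  by move: c0; rewrite cE; lra.
exists t1, t2; split=> //; first by rewrite t10.
split=> t.
- by move=> t0 tt1; rewrite cE nmulr_rgt0 ?nmulr_rlt0; lra.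
- by move=> t0 tt1; rewrite cE pmulr_rlt0 ?nmulr_rlt0; lra.
- by move=> t0; rewrite cE !mulr_gt0//; lra.
Qed.

End CubicArgmin.

(** * The profile on the critical lines *)

Definition hfun {R : realType} (a1 a2 x : R) : R :=
  2^-1 * a2 * x ^+ 2 + a1 * x + bfun x.

Definition slope {R : realType} (x : R) : R := Num.sqrt (x^-1 - 1).

Section Slope.
Context {R : realType}.
Implicit Types t x : R.

Definition slope_inv t : R := (1 + t ^+ 2)^-1.

Let t2_gt0 t : 0 < 1 + t ^+ 2. Proof. by rewrite ltr_wpDr ?sqr_ge0. Qed.

Lemma slope_inv_I01 t : 0 < t -> I01 (slope_inv t).
Proof.
move=> t0; rewrite /I01/= /slope_inv invr_gt0 t2_gt0/= invf_lt1 ?t2_gt0//.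
by rewrite ltrDl exprn_gt0.
Qed.

Lemma slope_gt0 x : I01 x -> 0 < slope x.
Proof. by move=> /andP[x0 x1]; rewrite /slope sqrtr_gt0 subr_gt0 invf_gt1. Qed.

Lemma slopeK x : I01 x -> slope_inv (slope x) = x.
Proof.
move=> /andP[x0 x1]; rewrite /slope_inv /slope sqr_sqrtr.
  by rewrite addrC subrK invrK.
by rewrite subr_ge0 ltW// invf_gt1.
Qed.

Lemma slope_invK t : 0 < t -> slope (slope_inv t) = t.
Proof.
move=> t0; rewrite /slope /slope_inv invrK addrC addKr sqrtr_sqr gtr0_norm//.
Qed.

Lemma ltr_slope_inv : {in Num.pos &, {mono slope_inv : s t /~ s < t}}.
Proof.
move=> s t s0 t0; rewrite /slope_inv ltf_pV2 ?posrE ?t2_gt0//.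
by rewrite ltrD2l ltr_pXn2r// nnegrE ltW.
Qed.

(** Together with [slope_gt], this carries the sign intervals of the cubic in [t] over to intervals
    in [x], with the order reversed. *)
Lemma slope_lt t x : 0 < t -> I01 x -> (slope x < t) = (slope_inv t < x).
Proof.
move=> t0 x01; rewrite -[in RHS](slopeK _ x01) ltr_slope_inv ?posrE//.
exact: slope_gt0.
Qed.

Lemma slope_gt t x : 0 < t -> I01 x -> (t < slope x) = (x < slope_inv t).
Proof.
move=> t0 x01; rewrite -[in RHS](slopeK _ x01) ltr_slope_inv ?posrE//.
exact: slope_gt0.
Qed.

(** The substitution makes the radicand a perfect square, so [b] becomes rational in [t]. *)
Lemma bfun_slope_inv t : 0 < t -> bfun (slope_inv t) = t ^+ 3 / (1 + t ^+ 2) ^+ 2.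
Proof.
move=> t0; rewrite /bfun /slope_inv.
have n0 : 1 + t ^+ 2 != 0 by rewrite gt_eqF ?t2_gt0.
have -> : (1 - (1 + t ^+ 2)^-1) ^+ 3 * (1 + t ^+ 2)^-1 =
  (t ^+ 3 / (1 + t ^+ 2) ^+ 2) ^+ 2 by field.
by rewrite sqrtr_sqr gtr0_norm// divr_gt0 ?exprn_gt0 ?t2_gt0.
Qed.

Lemma bfun_gt0 x : I01 x -> 0 < bfun x.
Proof.
move=> x01; rewrite -(slopeK _ x01) bfun_slope_inv ?slope_gt0//.
by rewrite divr_gt0 ?exprn_gt0 ?t2_gt0 ?slope_gt0.
Qed.

Definition dbfun x : R := x / 2 * (slope x ^+ 3 - 3 * slope x).

Lemma is_derive_bfun x : I01 x -> is_derive x (1 : R) bfun (dbfun x).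
Proof.
move=> x01; have t0 := slope_gt0 _ x01.
pose u : R -> R := (cst 1 - id) ^+ 3 * id.
have uE y : u y = (1 - y) ^+ 3 * y by [].
have -> : bfun = Num.sqrt \o u by apply/funext => y.
have ux : 0 < u x.
  by move/andP: x01 => [x0 x1]; rewrite uE mulr_gt0// exprn_gt0// subr_gt0.
have du : is_derive x (1 : R) u ((1 - x) ^+ 3 - 3 * (1 - x) ^+ 2 * x).
  by rewrite /u; apply: is_derive_eq; rewrite /GRing.scale/= !fctE /cst/=; ring.
apply: is_derive_eq.
  exact: (@is_derive1_comp _ Num.sqrt u x _ _ (is_derive1_sqrt ux) du).
(* Everything is expressed through [slope x], so that the remaining identity is rational. *)
have -> : Num.sqrt (u x) = slope x ^+ 3 / (1 + slope x ^+ 2) ^+ 2.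
  by rewrite -bfun_slope_inv// slopeK.
rewrite /dbfun -[in LHS](slopeK _ x01) -[X in _ = X / 2 * _](slopeK _ x01).
rewrite /slope_inv slope_invK//.
have n0 : 1 + slope x ^+ 2 != 0 by rewrite gt_eqF ?t2_gt0.
by field; rewrite n0 gt_eqF.
Qed.

(** Needed at the end points 0 and 1, which [is_derive_bfun] does not cover, to get monotonicity on
    closed intervals. *)
Lemma bfun_continuous : continuous (bfun : R -> R).
Proof.
move=> x; rewrite /bfun.
apply: (@continuous_comp _ _ _ (fun x : R => (1 - x) ^+ 3 * x) Num.sqrt).
  apply: cvgM; last exact: cvg_id.
  apply: (@continuous_comp _ _ _ (fun y : R => 1 - y) (fun z : R => z ^+ 3)).
    by apply: cvgB; [exact: cvg_cst|exact: cvg_id].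
  exact: exprn_continuous.
exact: sqrt_continuous.
Qed.

End Slope.

Section Profile.
Context {R : realType} (a1 a2 : R).
Implicit Types u v x : R.

Let h : R -> R := hfun a1 a2.

(** Since [x * (1 + t ^+ 2) = 1] for [t = slope x], the term [a1] is [x / 2] times
    [2 * a1 * (1 + t ^+ 2)]; thus [x / 2] factors out of the whole derivative. *)
Lemma is_derive_hfun x : I01 x ->
  is_derive x (1 : R) h (x / 2 * cubic a1 a2 (slope x)).
Proof.
move=> x01; have db := is_derive_bfun _ x01.
have -> : h = (2^-1 * a2) \*: (id ^+ 2) + a1 \*: id + bfun.
  by apply/funext => y.
apply: is_derive_eq; rewrite /GRing.scale/= /dbfun.
have t0 := slope_gt0 _ x01; set t := slope x.
have xE : x = (1 + t ^+ 2)^-1 by rewrite -[LHS]slopeK.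
have n0 : 1 + t ^+ 2 != 0 by rewrite gt_eqF// ltr_wpDr ?sqr_ge0.
by rewrite xE /cubic; field.
Qed.

Lemma hfun_continuous : continuous h.
Proof.
move=> x; apply: cvgD; last exact: bfun_continuous.
apply: cvgD; apply: cvgM.
- exact: cvg_cst.
- exact: exprn_continuous.
- exact: cvg_cst.
- exact: cvg_id.
Qed.

Lemma crit1_hfun x : crit1 h x <-> I01 x /\ cubic a1 a2 (slope x) = 0.
Proof.
split=> -[x01 d]; split=> //; have dh := is_derive_hfun _ x01.
  have /eqP := etrans (esym (@derive_val _ _ _ _ _ _ _ dh))
    (@derive_val _ _ _ _ _ _ _ d).
  move/andP: x01 => [x0 _].
  by rewrite !mulf_eq0 invr_eq0 pnatr_eq0 (gt_eqF x0)/= => /eqP.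
by apply: is_derive_eq; rewrite d mulr0.
Qed.

Lemma hfun_incr u v : 0 <= u -> v <= 1 ->
  (forall x, u < x < v -> 0 < cubic a1 a2 (slope x)) ->
  {in `[u, v] &, {homo h : x y / x < y}}.
Proof.
move=> u0 v1 P; have I x : x \in `]u, v[ -> I01 x.
  rewrite in_itv/= /I01/= => /andP[ux xv].
  by rewrite (le_lt_trans u0 ux) (lt_le_trans xv v1).
apply: gtr0_derive1_lt_cc => [x xuv|x xuv|].
- by have [] := is_derive_hfun _ (I _ xuv).
- rewrite derive1E (@derive_val _ _ _ _ _ _ _ (is_derive_hfun _ (I _ xuv))).
  have /andP[x0 _] := I _ xuv.
  by rewrite mulr_gt0 ?divr_gt0// P//; rewrite in_itv in xuv.
- by apply: continuous_subspaceT => x; exact: hfun_continuous.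
Qed.

Lemma hfun_decr u v : 0 <= u -> v <= 1 ->
  (forall x, u < x < v -> cubic a1 a2 (slope x) < 0) ->
  {in `[u, v] &, {homo h : x y /~ x < y}}.
Proof.
move=> u0 v1 P; have I x : x \in `]u, v[ -> I01 x.
  rewrite in_itv/= /I01/= => /andP[ux xv].
  by rewrite (le_lt_trans u0 ux) (lt_le_trans xv v1).
apply: ltr0_derive1_lt_cc => [x xuv|x xuv|].
- by have [] := is_derive_hfun _ (I _ xuv).
- rewrite derive1E (@derive_val _ _ _ _ _ _ _ (is_derive_hfun _ (I _ xuv))).
  have /andP[x0 _] := I _ xuv.
  by rewrite pmulr_rlt0 ?divr_gt0// P//; rewrite in_itv in xuv.
- by apply: continuous_subspaceT => x; exact: hfun_continuous.
Qed.

End Profile.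

(** * Local extrema and critical points on the interval, and their behaviour under a change of
    sign *)

Section LocExtremaLine.
Context {R : realType}.
Implicit Types (f : R -> R) (u v x : R).

Lemma loc_max_homo f u v x : u < x < v -> I01 x ->
  {in `[u, x] &, {homo f : y z / y < z}} ->
  {in `[x, v] &, {homo f : y z /~ y < z}} -> loc_max I01 f x.
Proof.
move=> /andP[ux xv] x01 fi fd; split=> //.
near=> y => _.
have uy : u < y by near: y; exact: lt_nbhsr.
have yv : y < v by near: y; exact: lt_nbhsl.
have [yx|xy|->//] := ltgtP y x.
  by apply: ltW; apply: fi => //; rewrite in_itv/= ?lexx ltW//= ltW.
by apply: ltW; apply: fd => //; rewrite in_itv/= ?lexx/= ltW//= ltW.
Unshelve. all: by end_near. Qed.

Lemma loc_minN (X : topologicalType) (D : set X) (f : X -> R) (p : X) :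
  loc_min D (\- f) p <-> loc_max D f p.
Proof.
split=> -[Dp fp]; split=> //; apply: filterS fp => q /[apply];
  by rewrite /= lerN2.
Qed.

Lemma loc_maxN (X : topologicalType) (D : set X) (f : X -> R) (p : X) :
  loc_max D (\- f) p <-> loc_min D f p.
Proof.
split=> -[Dp fp]; split=> //; apply: filterS fp => q /[apply];
  by rewrite /= lerN2.
Qed.

Lemma crit1N f x : crit1 (\- f) x <-> crit1 f x.
Proof.
have N (g : R -> R) : crit1 g x -> crit1 (\- g) x.
  move=> [x01 d]; split=> //.
  by have := is_deriveN d; rewrite oppr0.
split; last exact: N.
by move=> /N; congr crit1; apply/funext => y; rewrite /= opprK.
Qed.

(** Points just to the left of [x] have larger values. This is half of the saddle property of the
    second critical point. *)
Lemma not_loc_max_decr f u x : u < x -> I01 x ->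
  {in `[u, x] &, {homo f : y z /~ y < z}} -> ~ loc_max I01 f x.
Proof.
move=> ux x01 fd [_ fx].
have /andP[x0 x1] := x01.
near x^'- => y.
have yx : y < x by near: y; exact: nbhs_left_lt.
have y0 : 0 < y by near: y; exact: nbhs_left_gt.
have uy : u < y by near: y; exact: nbhs_left_gt.
have : I01 y -> f y <= f x by near: y; exact: cvg_within fx.
have yI : I01 y by rewrite /I01/= y0 (lt_trans yx).
move=> /(_ yI); rewrite leNgt => /negP; apply.
by apply: fd => //; rewrite in_itv/= ?lexx ?andbT ltW//= ltW.
Unshelve. all: by end_near. Qed.

Lemma card_set2 (x y : R) : x < y -> [set x; y] #= `I_2.
Proof.
move=> xy; pose f n := if n is 0%N then x else y.
have -> : [set x; y] = f @` `I_2.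
  apply/seteqP; split=> [z [->|->]|z [[|[|n]]//= _ <-]]; [by exists 0%N|by exists 1%N| |].
    by left.
  by right.
apply: inj_card_eq => -[|[|m]] [|[|n]]; rewrite ?inE//= => _ _ E;
  by move: xy; rewrite E ltxx.
Qed.

End LocExtremaLine.

(** * Shape of the profile for each position of [a2] relative to [- a1] and [gfun a1] *)

Section HfunProfile.
Context {R : realType} (a1 a2 : R).
Let h : R -> R := hfun a1 a2.

(** The profile increases from this value up to its maximum, which is therefore positive. *)
Lemma hfun0 : h 0 = 0.
Proof. by rewrite /h /hfun /bfun !mulr0 sqrtr0 expr0n/= mulr0 !addr0. Qed.

Lemma hfun_no_crit : gfun a1 < a2 ->
  [set x | crit1 h x] = set0 /\ {in I01 &, {homo h : x y / x < y}}.
Proof.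
move=> ga; have c x : I01 x -> 0 < cubic a1 a2 (slope x).
  by move=> x01; apply: cubic_gt0 => //; exact: slope_gt0.
split.
  apply/seteqP; split=> // x /crit1_hfun[/c cx cx0]; move: cx.
  by rewrite cx0 ltxx.
move=> x y; rewrite !inE => /andP[x0 x1] /andP[y0 y1].
apply: (@hfun_incr _ _ _ 0 1) => //; rewrite ?in_itv/= ?ltW//.
Qed.

(** As [slope] reverses the order, the signs of the cubic beyond and before its root [t1] give an
    increase before [slope_inv t1] and a decrease after it. *)
Lemma hfun_one_crit : a2 < - a1 ->
  exists x1, [/\ I01 x1, [set x | crit1 h x] = [set x1],
    loc_max I01 h x1 & 0 < h x1].
Proof.
move=> /cubic_one_root[t1 [t10 ct1 Pn Pp]].
have x01 := slope_inv_I01 _ t10; have /andP[x0 x1] := x01.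
have hi : {in `[0, slope_inv t1] &, {homo h : x y / x < y}}.
  apply: hfun_incr => //; first exact: ltW.
  move=> x /andP[y0 yx]; apply: Pp; rewrite slope_gt// /I01/= y0.
  exact: lt_trans x1.
have hd : {in `[slope_inv t1, 1] &, {homo h : x y /~ x < y}}.
  apply: hfun_decr => //; first exact: ltW.
  move=> x /andP[y0 yx]; have xI : I01 x by rewrite /I01/= yx (lt_trans x0).
  by apply: Pn; rewrite ?slope_gt0// slope_lt.
exists (slope_inv t1); split=> //.
- apply/seteqP; split=> [x /crit1_hfun[xI cx]|_ ->]; last first.
    by apply/crit1_hfun; rewrite slope_invK.
  have t0 := slope_gt0 _ xI.
  have [|/Pp|<-] := ltgtP (slope x) t1; last by rewrite slopeK.
    by move=> /(Pn _ t0); rewrite cx ltxx.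
  by rewrite cx ltxx.
- by apply: (@loc_max_homo _ _ 0 1).
- by rewrite -hfun0; apply: hi => //; rewrite in_itv/= ?lexx ltW.
Qed.

Lemma hfun_two_crit : - a1 < a2 < gfun a1 ->
  exists x1 x2, [/\ 0 < x1 /\ x1 < x2 /\ x2 < 1,
    [set x | crit1 h x] = [set x1; x2],
    loc_max I01 h x1, 0 < h x1
  & loc_min I01 h x2 /\ ~ loc_max I01 h x2].
Proof.
move=> /cubic_two_roots[t1 [t2 [/andP[t10 t12] ct1 ct2 [P1 P2 P3]]]].
have t20 : 0 < t2 by exact: lt_trans t12.
have x01 := slope_inv_I01 _ t10; have /andP[x0 x1] := x01.
have y01 := slope_inv_I01 _ t20; have /andP[y0 y1] := y01.
have yx : slope_inv t2 < slope_inv t1 by rewrite ltr_slope_inv.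
have hi : {in `[0, slope_inv t2] &, {homo h : x y / x < y}}.
  apply: hfun_incr => //; first exact: ltW.
  move=> z /andP[z0 zy]; apply: P3; rewrite slope_gt// /I01/= z0.
  exact: lt_trans y1.
have hd : {in `[slope_inv t2, slope_inv t1] &, {homo h : x y /~ x < y}}.
  apply: hfun_decr => //; [exact: ltW|exact: ltW|].
  move=> z /andP[yz zx].
  have zI : I01 z by rewrite /I01/= (lt_trans y0 yz) (lt_trans zx x1).
  by apply: P2; rewrite ?slope_gt// slope_lt.
have hi' : {in `[slope_inv t1, 1] &, {homo h : x y / x < y}}.
  apply: hfun_incr => //; first exact: ltW.
  move=> z /andP[xz z1]; have zI : I01 z by rewrite /I01/= z1 (lt_trans x0).
  by apply: P1; rewrite ?slope_gt0// slope_lt.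
(* The larger root [t2] yields the smaller critical point, which is the maximum. *)
exists (slope_inv t2), (slope_inv t1); split=> //.
- apply/seteqP; split=> [x /crit1_hfun[xI cx]|_ [->|->]]; last 2 first.
    by apply/crit1_hfun; rewrite slope_invK.
    by apply/crit1_hfun; rewrite slope_invK.
  have t0 := slope_gt0 _ xI.
  have [|t1x|tx] := ltgtP (slope x) t1; last by right; rewrite -tx slopeK.
    by move=> /(P1 _ t0); rewrite cx ltxx.
  have [|/P3|tx] := ltgtP (slope x) t2; last by left; rewrite -tx slopeK.
    by move=> /(P2 _ t1x); rewrite cx ltxx.
  by rewrite cx ltxx.
- by apply: (@loc_max_homo _ _ 0 (slope_inv t1)); rewrite ?y0.
- by rewrite -hfun0; apply: hi => //; rewrite in_itv/= ?lexx ltW.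
- split; last exact: (not_loc_max_decr _ _ _ yx).
  apply/loc_maxN/(@loc_max_homo _ _ (slope_inv t2) 1); rewrite ?yx//.
    by move=> x y xI yI xy /=; rewrite ltrN2 hd.
  by move=> x y xI yI xy /=; rewrite ltrN2 hi'.
Qed.

End HfunProfile.

(** * The function of two variables *)

Section Annulus.
Context {R : realType} (a1 a2 : R).
Implicit Types s x : R.

Let F := Ffun a1 a2.

Lemma Ffun_angle s x :
  F (angle s, x) = 2^-1 * a2 * x ^+ 2 + a1 * x + bfun x * cos s.
Proof. by rewrite /F /Ffun/= ccos_angle. Qed.

Lemma Ffun_angle0 : (fun x => F (angle 0, x)) = hfun a1 a2.
Proof. by apply/funext => x; rewrite Ffun_angle cos0 mulr1. Qed.

Lemma Ffun_anglepi : (fun x => F (angle pi, x)) = \- hfun (- a1) (- a2).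
Proof.
by apply/funext => x /=; rewrite Ffun_angle cospi /hfun; ring.
Qed.

(** The neighbourhood is a band around the whole circle: the comparison with the line of angle 0
    holds at every angle. *)
Lemma loc_max_angle0 x :
  loc_max I01 (fun x => F (angle 0, x)) x -> loc_max annulus F (angle 0, x).
Proof.
move=> [x01 fx]; split; first by split.
have : \forall q \near (angle 0 : circle R, x), I01 q.2 -> F (angle 0, q.2) <= F (angle 0, x).
  have c : q.2 @[q --> (angle 0 : circle R, x)] --> x by exact: cvg_snd.
  exact: c _ fx.
apply: filterS => -[psi y] /= fy [_ /= y01]; apply: le_trans (fy y01).
rewrite Ffun_angle cos0 /F /Ffun/= lerD2l ler_wpM2l ?sqrtr_ge0//.
exact: cos_le1.
Qed.

Lemma loc_min_anglepi x :
  loc_min I01 (fun x => F (angle pi, x)) x -> loc_min annulus F (angle pi, x).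
Proof.
move=> [x01 fx]; split; first by split.
have : \forall q \near (angle pi : circle R, x), I01 q.2 -> F (angle pi, x) <= F (angle pi, q.2).
  have c : q.2 @[q --> (angle pi : circle R, x)] --> x by exact: cvg_snd.
  exact: c _ fx.
apply: filterS => -[psi y] /= fy [_ /= y01]; apply: le_trans (fy y01) _.
rewrite Ffun_angle cospi /F /Ffun/= lerD2l ler_wpM2l ?sqrtr_ge0//.
exact: cos_geN1.
Qed.

(** Used by contraposition: what is no maximum on the line is no maximum on the annulus. *)
Lemma loc_max_line s x :
  loc_max annulus F (angle s, x) -> loc_max I01 (fun x => F (angle s, x)) x.
Proof.
move=> [[_ x01] fx]; split=> //.
have c : (fun y : R => (angle s : circle R, y)) y @[y --> x] --> (angle s : circle R, x).
  exact: (@cvg_pair _ _ _ (nbhs x) (nbhs (angle s : circle R)) (nbhs x) _ _ _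
    (fun=> angle s) id (cvg_cst _) cvg_id).
have {}fx : \forall y \near x, annulus (angle s, y) -> F (angle s, y) <= F (angle s, x).
  exact: c _ fx.
by apply: filterS fx => y /= fy y01; apply: fy; split.
Qed.

Lemma loc_min_line s x :
  loc_min annulus F (angle s, x) -> loc_min I01 (fun x => F (angle s, x)) x.
Proof.
move=> [[_ x01] fx]; split=> //.
have c : (fun y : R => (angle s : circle R, y)) y @[y --> x] --> (angle s : circle R, x).
  exact: (@cvg_pair _ _ _ (nbhs x) (nbhs (angle s : circle R)) (nbhs x) _ _ _
    (fun=> angle s) id (cvg_cst _) cvg_id).
have {}fx : \forall y \near x, annulus (angle s, y) -> F (angle s, x) <= F (angle s, y).
  exact: c _ fx.
by apply: filterS fx => y /= fy y01; apply: fy; split.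
Qed.

Lemma cvg_angle s x : (angle t : circle R, x) @[t --> s] --> (angle s : circle R, x).
Proof.
apply: (@cvg_pair _ _ _ (nbhs s) (nbhs (angle s : circle R)) (nbhs x) _ _ _
    (fun t => angle t) (fun=> x) _ (cvg_cst _)).
exact: (@pi_continuous _ (Quotient.quot (@two_pi_Z R)) s).
Qed.

(** Turning the angle at fixed [x] strictly lowers [F], because [b(x) > 0] and [cos] strictly
    decreases on [[0, pi]]. *)
Lemma not_loc_min_angle0 x : ~ loc_min annulus F (angle 0, x).
Proof.
move=> [[_ /= x01] fx]; have {}fx : \forall s \near (0 : R), annulus (angle s, x) ->
    F (angle 0, x) <= F (angle s, x).
  exact: cvg_angle 0 x _ fx.
near (0 : R)^'+ => s.
have s0 : 0 < s by near: s; exact: nbhs_right_gt.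
have spi : s < pi by near: s; exact: nbhs_right_lt (pi_gt0 R).
have : annulus (angle s, x) -> F (angle 0, x) <= F (angle s, x).
  by near: s; exact: cvg_within fx.
move=> /(_ (conj I x01)); rewrite !Ffun_angle lerD2l ler_pM2l ?bfun_gt0//.
by rewrite leNgt ltr_cos ?s0// in_itv/= ?lexx ?pi_ge0// !ltW.
Unshelve. all: by end_near. Qed.

Lemma not_loc_max_anglepi x : ~ loc_max annulus F (angle pi, x).
Proof.
move=> [[_ /= x01] fx]; have {}fx : \forall s \near (pi : R), annulus (angle s, x) ->
    F (angle s, x) <= F (angle pi, x).
  exact: cvg_angle pi x _ fx.
(* [pi] is approached from below to stay where [cos] is known to be monotone. *)
near (pi : R)^'- => s.
have s0 : 0 < s by near: s; exact: nbhs_left_gt (pi_gt0 R).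
have spi : s < pi by near: s; exact: nbhs_left_lt.
have : annulus (angle s, x) -> F (angle s, x) <= F (angle pi, x).
  by near: s; exact: cvg_within fx.
move=> /(_ (conj I x01)); rewrite !Ffun_angle lerD2l ler_pM2l ?bfun_gt0//.
by rewrite leNgt ltr_cos ?spi// in_itv/= ?lexx ?pi_ge0// !ltW.
Unshelve. all: by end_near. Qed.

Lemma is_derive_line s x : I01 x ->
  is_derive x (1 : R) (fun x => F (angle s, x))
    (a2 * x + a1 + dbfun x * cos s).
Proof.
move=> x01; have db := is_derive_bfun _ x01.
have -> : (fun x => F (angle s, x)) =
  (2^-1 * a2) \*: (id ^+ 2) + a1 \*: id + cos s \*: bfun.
  by apply/funext => y; rewrite Ffun_angle [bfun y * _]mulrC.
by apply: is_derive_eq; rewrite /GRing.scale/=; field.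
Qed.

Lemma is_diff_bfun x : I01 x -> is_diff x bfun (fun d => d * dbfun x).
Proof.
move=> x01; have [db dbE] := is_derive_bfun _ x01.
have dif : differentiable (bfun : R -> R) x by apply/derivable1_diffP.
apply: DiffDef => //.
by rewrite diff1E// derive1E dbE.
Qed.

Lemma is_diff_ext (V W : normedModType R) (f g df dg : V -> W) (p : V) :
  is_diff p f df -> f =1 g -> df =1 dg -> is_diff p g dg.
Proof. by move=> + /funext <- /funext <-. Qed.

Lemma is_diff_fst (V W : normedModType R) (p : V * W) : is_diff p fst fst.
Proof.
have c : continuous (@fst V W) by move=> q; exact: cvg_fst.
by apply: DiffDef; [exact: linear_differentiable|rewrite diff_lin].
Qed.

Lemma is_diff_snd (V W : normedModType R) (p : V * W) : is_diff p snd snd.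
Proof.
have c : continuous (@snd V W) by move=> q; exact: cvg_snd.
by apply: DiffDef; [exact: linear_differentiable|rewrite diff_lin].
Qed.

Lemma is_diff_cos (s : R) : is_diff s cos (fun d => - (d * sin s)).
Proof.
have dif : differentiable (cos : R -> R) s by apply/derivable1_diffP.
apply: DiffDef => //; rewrite diff1E// derive1E derive_val.
by apply/funext => d; rewrite /GRing.scale/= mulrN.
Qed.

Lemma is_diff_annulus s x : I01 x ->
  is_diff (s, x) (fun q : R * R => F (angle q.1, q.2))
    (fun d => (a2 * x + a1 + dbfun x * cos s) * d.2 - bfun x * sin s * d.1).
Proof.
move=> x01; have d1 := is_diff_fst _ _ (s, x); have d2 := is_diff_snd _ _ (s, x).
have dc := is_diff_comp d1 (is_diff_cos s).
have db := is_diff_comp d2 (is_diff_bfun _ x01).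
(* The index 1 in [is_diffX] stands for the exponent 2. *)
have D := is_diffD (is_diffD (is_diffZ (2^-1 * a2) (is_diffX 1 d2))
  (is_diffZ a1 d2)) (is_diffM db dc).
apply: (is_diff_ext _ _ _ _ _ _ _ D) => d; first by rewrite Ffun_angle.
rewrite !fctE /GRing.scale/=.
by field.
Qed.

(** Here [sin s = 0], so the angular part of the differential vanishes and only the derivative in
    [x] remains. *)
Lemma crit2_angle s x : cos s ^+ 2 = 1 ->
  crit2 F (angle s, x) <-> crit1 (fun x => F (angle s, x)) x.
Proof.
move=> cs; split.
  move=> [[_ /= x01] /(_ s erefl)/= d]; split=> //.
  have := is_derive_line s _ x01.
  have e := etrans (esym (@diff_val _ _ _ _ _ _ _ d))
    (@diff_val _ _ _ _ _ _ _ (is_diff_annulus s _ x01)).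
  by move/(congr1 (fun f => f (0, 1))): e => /=; rewrite /cst mulr1 mulr0 subr0 => <-.
move=> [x01 d]; split; first by split.
(* Every lift [t] of the angle must be treated; it has the same cosine as [s], hence sine 0. *)
move=> t /= ts.
have ct : cos t = cos s by rewrite -!ccos_angle ts.
have st : sin t = 0.
  by apply/eqP; rewrite -sqrf_eq0 sin2cos2 ct cs subrr.
have := is_diff_annulus t _ x01.
have e := etrans (esym (@derive_val _ _ _ _ _ _ _ d))
    (@derive_val _ _ _ _ _ _ _ (is_derive_line s _ x01)).
rewrite ct st -e; congr is_diff_def.
by apply/funext => v; rewrite mul0r mulr0 mul0r subr0.
Qed.

Lemma card_crit2 s (n : nat) : cos s ^+ 2 = 1 ->
  [set x | crit1 (fun x => F (angle s, x)) x] #= `I_n ->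
  [set p | crit2 F p /\ p.1 = angle s] #= `I_n.
Proof.
move=> cs; apply: card_eq_trans.
rewrite (_ : [set p | _] =
  (fun x => (angle s, x)) @` [set x | crit1 (fun x => F (angle s, x)) x]).
  by apply: inj_card_eq => x y _ _ [].
apply/seteqP; split=> [[psi x]/= [c psiE]|_ [x cx <-]]/=.
  by exists x; [apply/crit2_angle => //; rewrite -psiE|rewrite psiE].
by split=> //; apply/crit2_angle.
Qed.

End Annulus.

(** * The four regions, from the profiles for [(a1, a2)] and [(- a1, - a2)] *)

Theorem proposition1 (R : realType) (a1 a2 : R) :
  let F := Ffun a1 a2 in
  let F0 := fun x : R => F (angle 0, x) in
  let Fpi := fun x : R => F (angle pi, x) in
  (forall i j : nat, Zreg R i j (a1, a2) ->
    [/\ [set x | crit1 F0 x] #= `I_i,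
        [set x | crit1 Fpi x] #= `I_j,
        [set p | crit2 F p /\ p.1 = angle 0] #= `I_i
      & [set p | crit2 F p /\ p.1 = angle pi] #= `I_j]) /\
  (Zreg R 1 0 (a1, a2) ->
    exists x10 : R,
      [/\ loc_max I01 F0 x10, 0 < F0 x10,
          {in I01 &, forall x y, x < y -> Fpi y < Fpi x}
        & loc_max annulus F (angle 0, x10)]) /\
  (Zreg R 0 1 (a1, a2) ->
    exists x1pi : R,
      [/\ loc_min I01 Fpi x1pi, Fpi x1pi < 0,
          {in I01 &, forall x y, x < y -> F0 x < F0 y}
        & loc_min annulus F (angle pi, x1pi)]) /\
  (Zreg R 1 2 (a1, a2) ->
    exists x10 x1pi x2pi : R,
      [/\ loc_max I01 F0 x10 /\ 0 < F0 x10,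
          [/\ loc_min I01 Fpi x1pi, Fpi x1pi < 0, loc_max I01 Fpi x2pi
            & 0 < x1pi /\ x1pi < x2pi /\ x2pi < 1],
          loc_max annulus F (angle 0, x10),
          loc_min annulus F (angle pi, x1pi)
        & saddle2 F (angle pi, x2pi)]) /\
  (Zreg R 2 1 (a1, a2) ->
    exists x10 x20 x1pi : R,
      [/\ [/\ loc_max I01 F0 x10, 0 < F0 x10, loc_min I01 F0 x20
            & 0 < x10 /\ x10 < x20 /\ x20 < 1],
          loc_min I01 Fpi x1pi /\ Fpi x1pi < 0,
          loc_max annulus F (angle 0, x10),
          saddle2 F (angle 0, x20)
        & loc_min annulus F (angle pi, x1pi)]).
Proof.
move=> F F0 Fpi.
have F0E : F0 = hfun a1 a2 := Ffun_angle0 a1 a2.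
have FpiE : Fpi = \- hfun (- a1) (- a2) := Ffun_anglepi a1 a2.
have c0 : cos 0 ^+ 2 = 1 :> R by rewrite cos0 expr1n.
have cpi : cos pi ^+ 2 = 1 :> R by rewrite cospi sqrrN expr1n.
have critpi : [set x | crit1 Fpi x] = [set x | crit1 (hfun (- a1) (- a2)) x].
  by apply/seteqP; split=> x /=; rewrite FpiE => /crit1N.
have loc0 x : loc_max I01 F0 x -> loc_max annulus F (angle 0, x).
  exact: loc_max_angle0.
have locpi x : loc_max I01 (hfun (- a1) (- a2)) x ->
    loc_min I01 Fpi x /\ loc_min annulus F (angle pi, x).
  move=> hx; have mx : loc_min I01 Fpi x by rewrite FpiE; apply/loc_minN.
  by split=> //; exact: loc_min_anglepi.
(* These bounds place [a2] relative to [- a1] in [Z10] and [Z01], so that each region becomes a pair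
   of hypotheses, one for each profile. *)
have g1 := gfun_gtN a1; have g2 := gfun_gtN (- a1).
have Z10 : Zreg R 1 0 (a1, a2) -> a2 < - a1 /\ gfun (- a1) < - a2.
  by rewrite /Zreg/=; lra.
have Z01 : Zreg R 0 1 (a1, a2) -> gfun a1 < a2 /\ - a2 < - (- a1).
  by rewrite /Zreg/=; lra.
have Z12 : Zreg R 1 2 (a1, a2) -> a2 < - a1 /\ - (- a1) < - a2 < gfun (- a1).
  by rewrite /Zreg/=; lra.
have Z21 : Zreg R 2 1 (a1, a2) -> - a1 < a2 < gfun a1 /\ - a2 < - (- a1).
  by rewrite /Zreg/=; lra.
split; last split; last split; last split.
- move=> i j Z.
  suff [c0i cpij] : [set x | crit1 F0 x] #= `I_i /\ [set x | crit1 Fpi x] #= `I_j.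
    by split=> //; exact: card_crit2.
  rewrite critpi F0E.
  (* For all but four index pairs [Zreg] is empty. *)
  move: i j Z => [|[|[|i]]] [|[|[|j]]] //.
  + move=> /Z01[/hfun_no_crit[-> _] /hfun_one_crit[x [_ -> _ _]]].
    by rewrite II0; split=> //; exact: card_set1.
  + move=> /Z10[/hfun_one_crit[x [_ -> _ _]] /hfun_no_crit[-> _]].
    by rewrite II0; split=> //; exact: card_set1.
  + move=> /Z12[/hfun_one_crit[x [_ -> _ _]] /hfun_two_crit[y [z [[_ [yz _]] -> _ _ _]]]].
    by split; [exact: card_set1|exact: card_set2].
  + move=> /Z21[/hfun_two_crit[y [z [[_ [yz _]] -> _ _ _]]] /hfun_one_crit[x [_ -> _ _]]].
    by split; [exact: card_set2|exact: card_set1].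
- move=> /Z10[/hfun_one_crit[x [_ _ mx px]] /hfun_no_crit[_ hi]].
  exists x; rewrite -F0E in mx px; split=> //; last exact: loc0.
  by move=> y z yI zI yz; rewrite FpiE /= ltrN2 hi.
- move=> /Z01[/hfun_no_crit[_ hi] /hfun_one_crit[x [_ _ /locpi[mx mx'] px]]].
  exists x; split=> //; first by rewrite FpiE/= oppr_lt0.
  by rewrite F0E.
- move=> /Z12[/hfun_one_crit[x [_ _ mx px]]].
  move=> /hfun_two_crit[y [z [[y0 [yz z1]] cE /locpi[my my'] py [nz xz]]]].
  exists x, y, z; rewrite -F0E in mx px.
  have cz : crit1 Fpi z.
    by have : [set x | crit1 Fpi x] z by rewrite critpi cE; right.
  split=> //; last 2 first.
  + exact: loc0.
  (* The angular direction excludes a maximum; the line of angle [pi], on which [z] is a maximum and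
     not a minimum, excludes a minimum. *)
  + split; first by apply/(crit2_angle _ _ _ _ cpi).
      exact: not_loc_max_anglepi.
    move=> /loc_min_line; rewrite -/Fpi; change (~ loc_min I01 Fpi z).
    by rewrite FpiE => /loc_minN.
  + by split=> //; [rewrite FpiE/= oppr_lt0|rewrite FpiE; apply/loc_maxN].
- move=> /Z21[/hfun_two_crit[y [z [[y0 [yz z1]] cE my py [nz xz]]]]].
  move=> /hfun_one_crit[x [_ _ /locpi[mx mx'] px]].
  exists y, z, x; rewrite -F0E in my py nz xz.
  have cz : crit1 F0 z.
    by have : [set x | crit1 F0 x] z by rewrite F0E cE; right.
  split=> //.
  + by split=> //; rewrite FpiE/= oppr_lt0.
  + exact: loc0.
  (* The roles are exchanged: the line of angle 0 excludes a maximum, the angular direction a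
     minimum. *)
  + split; first by apply/(crit2_angle _ _ _ _ c0).
      by move=> /loc_max_line.
    exact: not_loc_min_angle0.
Qed.
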